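(* Let $n\ge 2$. For each measurable function $f:\mathbb{R}\to\mathbb{R}$ and each real number $x$, the following are equivalent: (a) the Peano derivative $f_{(n-1)}(x)$ exists and, for every $j=0,1,\dots,n-2$, the limit $$D_{n,j}f(x)=\lim_{h\to0}h^{-n}\sum_{i=0}^n(-1)^i\binom ni f\big(x+(n+j-i)h\big)$$ exists (as a finite real number); (b) the Peano derivative $f_{(n)}(x)$ exists. *)

(* Defs.v *)
From mathcomp Require Import all_boot all_order all_algebra.
From mathcomp Require Import all_classical all_reals all_analysis.
Set Implicit Arguments. Unset Strict Implicit. Unset Printing Implicit Defensive.
Import Order.TTheory GRing.Theory Num.Theory.
Import numFieldNormedType.Exports.
Local Open Scope classical_set_scope.
Local Open Scope ring_scope.

(* Lebesgue measurability of f : R -> R: the preimage of every Borel set is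
   Lebesgue measurable, i.e. Caratheodory-measurable for the Lebesgue outer
   measure (the outer measure induced by the interval length). *)
Definition lebesgue_measurable_fun (R : realType) (f : R -> R) : Prop :=
  forall B : set R, measurable B ->
    (@wlength R idfun)^*%mu.-cara.-measurable (f @^-1` B).

Definition peano_deriv_exists (R : realType) (f : R -> R) (x : R) (k : nat)
  : Prop :=
  exists a : nat -> R, a 0%N = f x /\
    (fun h : R => (f (x + h) - \sum_(i < k.+1) a i * h ^+ i / (i`!)%:R)
                  / h ^+ k) @ 0^' --> 0.

Definition Dquot (R : realType) (n j : nat) (f : R -> R) (x h : R) : R :=
  h ^- n * \sum_(i < n.+1)
      (-1) ^+ i * ('C(n, i))%:R * f (x + ((n + j)%:R - i%:R) * h).

Definition Dnj_exists (R : realType) (n j : nat) (f : R -> R) (x : R) : Prop :=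
  exists L : R, Dquot n j f x h @[h --> 0^'] --> L.

(* Main.v *)
(** Subtracting a Taylor polynomial at x, assume F(h) = f(x+h) - p(h) is
    o(h^(n-1)) with F(0) = 0.  Let P_h be the polynomial of degree < n
    interpolating k |-> F(kh) at k = 0, ..., n-1.  An n-th difference kills
    P_h, so the n-1 shifted differences being of the form c h^n + o(h^n) extends
    the interpolation, up to errors of this form, to the nodes k <= 2n-2.  These
    include the even nodes 2k with k < n, hence P_{2h}(t) = P_h(2t) up to such
    an error.  Its s-th coefficient g_s thus satisfies
    g_s(2h) - 2^s g_s(h) = c h^n + o(h^n) with s < n, and as
    g_s(h) = o(h^(n-1)), iterating along h, h/2, h/4, ... shows that g_s itself
    is of this form; so is F(h) = P_h(1). *)
Require Import Defs.
From mathcomp Require Import all_boot all_order all_algebra.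
From mathcomp Require Import all_classical all_reals all_analysis.
From mathcomp Require Import ring lra zify.
Set Implicit Arguments. Unset Strict Implicit. Unset Printing Implicit Defensive.
Import Order.TTheory GRing.Theory Num.Theory.
Import numFieldNormedType.Exports.
Local Open Scope classical_set_scope.
Local Open Scope ring_scope.

(** * Finite differences of polynomials *)

Lemma sum_binN_horner (R : comNzRingType) (n : nat) (p : {poly R}) (y : R) :
  (size p <= n)%N ->
  \sum_(i < n.+1) (-1) ^+ i * 'C(n, i)%:R * p.[y - i%:R] = 0.
Proof.
elim: n p y => [|n IHn] p y sp.
  move: sp; rewrite leqn0 size_poly_eq0 => /eqP->.
  by rewrite big1 // => i _; rewrite horner0 mulr0.
(* A backward difference lowers the degree, and Pascal's rule turns the difference of order [n.+1]
   of [p] into the one of order [n] of [q]. *)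
pose q := p - (p \Po ('X - 1)).
have sq : (size q <= n)%N.
  rewrite (_ : q = \sum_(i < size p) p`_i *: ('X^i - ('X - 1) ^+ i)); last first.
    rewrite /q comp_polyE -[X in X - _]coefK poly_def -sumrB.
    by apply: eq_bigr => i _; rewrite scalerBr.
  apply: leq_trans (size_sum _ _ _) _; apply/bigmax_leqP => i _.
  apply: leq_trans (size_scale_leq _ _) _.
  rewrite subrXX opprB addrC subrK mul1r.
  apply: leq_trans (size_sum _ _ _) _; apply/bigmax_leqP => j _.
  apply: leq_trans (size_polyMleq _ _) _.
  rewrite -polyC1 size_polyXn size_exp_XsubC.
  by have := ltn_ord i; have := ltn_ord j; lia.
apply: etrans (IHn q y sq); rewrite /q.
rewrite [RHS](eq_bigr (fun i : 'I_n.+1 => (-1) ^+ i * 'C(n, i)%:R * p.[y - i%:R]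
   + (-1) ^+ i.+1 * 'C(n, i)%:R * p.[y - i.+1%:R])); last first.
  move=> i _; rewrite hornerD hornerN horner_comp !hornerE exprS.
  rewrite (_ : y - i.+1%:R = y - i%:R - 1); first by ring.
  by rewrite -addn1 natrD; ring.
rewrite big_split /= big_ord_recl /= big_ord_recr /= [in RHS]big_ord_recl /=.
rewrite [in X in _ = _ + X]big_ord_recr /=.
under eq_bigr do rewrite /bump /= add1n binS natrD mulrDr mulrDl.
rewrite big_split /= /bump /= !bin0 !binn.
under [in RHS]eq_bigr do rewrite add1n.
ring.
Qed.

(** * Functions of the form l h^n + o(h^n) at 0 *)

Section Asymp.
Context {R : realType}.
Implicit Types (f g : R -> R) (c : R) (n : nat).

(** The limit is left existential so that these functions form a class closed under linear
    combinations and dilations, which lets error terms go untracked. *)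
Definition has_order_coef n g :=
  exists l : R, g h / h ^+ n @[h --> 0^'] --> l.

Lemma cvg_scale_dnbhs0 c : c != 0 -> c * h @[h --> (0 : R)^'] --> (0 : R)^'.
Proof.
move=> c0 A; rewrite /dnbhs /within /= /nbhs /= => /nbhs_ballP[e /= e0 Ae].
apply/nbhs_ballP; exists (e / `|c|) => /=; first by rewrite divr_gt0 ?normr_gt0.
move=> h; rewrite /ball /= sub0r normrN => he h0.
apply: Ae; last by rewrite mulf_neq0.
by rewrite /ball /= sub0r normrN normrM mulrC -ltr_pdivlMr ?normr_gt0.
Qed.

Lemma has_order_coefZ n g c :
  has_order_coef n g -> has_order_coef n (fun h => c * g h).
Proof.
move=> [l gl]; exists (c * l).
under eq_fun do rewrite -mulrA.
exact: cvgMl_tmp.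
Qed.

Lemma has_order_coefD n f g : has_order_coef n f -> has_order_coef n g ->
  has_order_coef n (fun h => f h + g h).
Proof.
move=> [l fl] [m gm]; exists (l + m).
under eq_fun do rewrite mulrDl.
exact: cvgD.
Qed.

Lemma has_order_coef_sum n (I : Type) (r : seq I) (P : pred I) (G : I -> R -> R) :
  (forall i, P i -> has_order_coef n (G i)) ->
  has_order_coef n (fun h => \sum_(i <- r | P i) G i h).
Proof.
move=> PG; elim: r => [|i r IHr].
  exists 0; under eq_fun do rewrite big_nil mul0r.
  exact: cvg_cst.
under eq_fun do rewrite big_cons.
case: (boolP (P i)) => Pi //; apply: has_order_coefD => //; exact: PG.
Qed.

Lemma cvg_quot_dilate n g (c l : R) : c != 0 ->
  g h / h ^+ n @[h --> 0^'] --> l ->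
  g (c * h) / h ^+ n @[h --> 0^'] --> c ^+ n * l.
Proof.
move=> c0 gl.
have : c ^+ n * (g (c * h) / (c * h) ^+ n) @[h --> 0^'] --> c ^+ n * l.
  by apply: cvgMl_tmp; apply: cvg_comp (cvg_scale_dnbhs0 c0) gl.
apply: cvg_trans; apply: near_eq_cvg.
near=> h.
rewrite /= exprMn invfM; field.
rewrite !expf_neq0//.
near: h; exact: nbhs_dnbhs_neq.
Unshelve. all: by end_near. Qed.

Lemma has_order_coef_dilate n g c : g 0 = 0 ->
  has_order_coef n g -> has_order_coef n (fun h => g (c * h)).
Proof.
(* Dilation by 0, which occurs at the node 0 of a difference, gives the constant [g 0]; hence the
   hypothesis [g0]. *)
move=> g0; have [->|c0] := eqVneq c 0.
  exists 0; under eq_fun do rewrite mul0r g0 mul0r.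
  exact: cvg_cst.
move=> [l gl]; exists (c ^+ n * l); exact: cvg_quot_dilate.
Qed.

(** * The functional inequality under doubling *)

(** Halving the argument m times telescopes. The k-th halving costs 2^(s(k-1)) e |h|^n / 2^(kn), at
    most e |h|^n / 2^k because s < n; these bounds sum to the factor 1 - 2^-m. *)
Lemma doubling_iter n s (g : R -> R) (e d h : R) : (s < n)%N -> 0 <= e ->
  `|h| < d ->
  (forall t, t != 0 -> `|t| < d ->
     `|g (2 * t) - 2 ^+ s * g t| <= e * `|t| ^+ n) ->
  h != 0 -> forall m,
  `|g h| <= 2 ^+ (s * m) * `|g (h / 2 ^+ m)| + e * `|h| ^+ n * (1 - 2 ^- m).
Proof.
move=> sn e0 hd gP h0; elim=> [|m IHm].
  by rewrite muln0 !expr0 invr1 subrr mulr0 addr0 mul1r mulr1.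
apply: le_trans IHm _.
have p2 k : 0 < (2 : R) ^+ k by rewrite exprn_gt0.
have t0 : h / 2 ^+ m.+1 != 0 by rewrite mulf_neq0 // invr_eq0 lt0r_neq0.
have nt : `|h / 2 ^+ m.+1| = `|h| / 2 ^+ m.+1.
  by rewrite normrM normfV (ger0_norm (ltW (p2 _))).
have := gP _ t0.
have -> : 2 * (h / 2 ^+ m.+1) = h / 2 ^+ m.
  by rewrite exprS; field; rewrite lt0r_neq0.
have -> : `|h / 2 ^+ m.+1| < d.
  rewrite nt (le_lt_trans _ hd) // ler_pdivrMr // ler_peMr //.
  by rewrite exprn_ege1 // ler1n.
rewrite nt => /(_ isT).
set A := g (h / 2 ^+ m); set B := g (h / 2 ^+ m.+1) => AB.
have {AB} AB : `|A| <= 2 ^+ s * `|B| + e * (`|h| / 2 ^+ m.+1) ^+ n.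
  rewrite -lerBlDl; apply: le_trans AB.
  rewrite -[X in _ - X * _](ger0_norm (ltW (p2 s))) -normrM.
  exact: lerB_dist.
have : 2 ^+ (s * m) * `|A| <= 2 ^+ (s * m.+1) * `|B| + e * `|h| ^+ n * 2 ^- m.+1.
  apply: le_trans (ler_wpM2l (ltW (p2 _)) AB) _.
  rewrite mulrDr mulrA -exprD mulnS addnC lerD2l.
  rewrite mulrCA -mulrA ler_wpM2l // expr_div_n mulrCA ler_wpM2l ?exprn_ge0 //.
  rewrite -exprM ler_pdivrMr // mulrC ler_pdivlMr // -exprD.
  rewrite ler_eXn2l ?ltr1n //; apply: leq_trans (leq_mul (leqnn m.+1) sn).
  by rewrite mulnS mulSn [(m * s)%N]mulnC; lia.
have aux (a b v y : R) : a <= b + v * (2^-1 * y) ->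
    a + v * (1 - y) <= b + v * (1 - 2^-1 * y) by move=> ?; lra.
by rewrite [2 ^+ m.+1]exprS invfM; exact: aux.
Qed.

(** After m halvings the main term is 2^(sm) |g(h/2^m)|. As s <= n-1, the bound o(t^(n-1)) on g
    absorbs the factor 2^(sm), while the accumulated error stays below (e/2) |h|^n. *)
Lemma doubling_littleo n s g : (s < n)%N ->
  g h / h ^+ n.-1 @[h --> 0^'] --> (0 : R) ->
  (g (2 * h) - 2 ^+ s * g h) / h ^+ n @[h --> 0^'] --> (0 : R) ->
  g h / h ^+ n @[h --> 0^'] --> (0 : R).
Proof.
move=> sn /cvgr0Pnorm_le go /cvgr0Pnorm_le dbl; apply/cvgr0Pnorm_le => e e0.
have e20 : 0 < e / 2 by rewrite divr_gt0.
have /nbhs_ballP[d /= d0 dP] := dbl _ e20.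
have {}dP t : t != 0 -> `|t| < d ->
    `|g (2 * t) - 2 ^+ s * g t| <= e / 2 * `|t| ^+ n.
  move=> t0 td; have := dP t; rewrite /ball /= sub0r normrN => /(_ td t0).
  by rewrite normrM normfV normrX ler_pdivrMr // exprn_gt0 // normr_gt0.
near=> h.
have h0 : h != 0 by near: h; exact: nbhs_dnbhs_neq.
have nh0 : 0 < `|h| by rewrite normr_gt0.
have hd : `|h| < d by near: h; exact: dnbhs0_lt.
rewrite normrM normfV normrX ler_pdivrMr ?exprn_gt0 //.
(* Since h is fixed before m is chosen, the tolerance may depend on h: the factor |h| supplies the
   power missing between n-1 and n. *)
have /nbhs_ballP[d' /= d'0 d'P] := go _ (mulr_gt0 e20 nh0).
have /archi_boundP := divr_ge0 (ltW nh0) (ltW d'0).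
set m := Num.bound _ => hm.
have p2 k : 0 < (2 : R) ^+ k by rewrite exprn_gt0.
have nt : `|h / 2 ^+ m| = `|h| / 2 ^+ m.
  by rewrite normrM normfV (ger0_norm (ltW (p2 _))).
have td' : `|h / 2 ^+ m| < d'.
  rewrite nt ltr_pdivrMr // mulrC -ltr_pdivrMr //; apply: lt_trans hm _.
  by rewrite -natrX ltr_nat ltn_expl.
have := doubling_iter sn (ltW e20) hd dP h0 m.
have t0 : h / 2 ^+ m != 0 by rewrite mulf_neq0 // invr_eq0 lt0r_neq0.
have := d'P (h / 2 ^+ m); rewrite /ball /= sub0r normrN => /(_ td' t0).
rewrite normrM normfV normrX ler_pdivrMr ?exprn_gt0 ?normr_gt0 // nt.
move=> /(ler_wpM2l (ltW (p2 (s * m)%N))) gt gh.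
apply: le_trans gh _; rewrite [X in _ <= X * _]splitr mulrDl.
apply: lerD; last first.
  apply: ler_piMr; first by rewrite mulr_ge0 ?exprn_ge0 ?(ltW e20).
  by rewrite gerBl invr_ge0 ltW.
apply: le_trans gt _; rewrite mulrCA -(mulrA (e / 2)) ler_wpM2l ?(ltW e20) //.
case: n sn {go dbl dP d'P} => // n; rewrite ltnS => sn.
rewrite exprS ler_wpM2l //= expr_div_n mulrCA -[leRHS]mulr1.
rewrite ler_wpM2l ?exprn_ge0 // -exprM ler_pdivrMr // mul1r.
by rewrite ler_eXn2l ?ltr1n // mulnC leq_mul2l sn orbT.
Unshelve. all: by end_near. Qed.

(** Doubling sends c h^n to (2^n - 2^s) c h^n, and this factor is nonzero as s < n. Choosing c to
    match the limit [l] and subtracting c h^n reduces to the little-o case. *)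
Lemma has_order_coef_doubling n s g : (s < n)%N ->
  g h / h ^+ n.-1 @[h --> 0^'] --> (0 : R) ->
  has_order_coef n (fun h => g (2 * h) - 2 ^+ s * g h) ->
  has_order_coef n g.
Proof.
move=> sn go [l dbl].
have D0 : (2 : R) ^+ n - 2 ^+ s != 0.
  by rewrite subr_eq0 gt_eqF // ltr_eXn2l ?ltr1n.
pose c := l / (2 ^+ n - 2 ^+ s); exists c.
pose g1 h := g h - c * h ^+ n.
suff : g1 h / h ^+ n + c @[h --> 0^'] --> 0 + c.
  rewrite add0r; apply: cvg_trans; apply: near_eq_cvg; near=> h.
  have h0 : h != 0 by near: h; exact: nbhs_dnbhs_neq.
  by rewrite /g1; field; rewrite expf_neq0.
apply: cvgD; last exact: cvg_cst.
apply: (doubling_littleo sn).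
  have : g h / h ^+ n.-1 - c * h @[h --> 0^'] --> (0 - c * 0 : R).
    by apply: cvgB => //; apply: cvgMl_tmp; exact: cvg_within.
  rewrite mulr0 subr0; apply: cvg_trans; apply: near_eq_cvg; near=> h.
  have h0 : h != 0 by near: h; exact: nbhs_dnbhs_neq.
  have -> : g1 h = g h - c * (h * h ^+ n.-1).
    by rewrite -exprS prednK // (leq_ltn_trans _ sn).
  by field; rewrite expf_neq0.
have : (g (2 * h) - 2 ^+ s * g h) / h ^+ n - l @[h --> 0^'] --> l - l.
  by apply: cvgB => //; exact: cvg_cst.
rewrite subrr; apply: cvg_trans; apply: near_eq_cvg; near=> h.
have h0 : h != 0 by near: h; exact: nbhs_dnbhs_neq.
rewrite /g1 exprMn {1}(_ : l = c * (2 ^+ n - 2 ^+ s)); last by rewrite /c divfK.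
by field; rewrite expf_neq0.
Unshelve. all: by end_near. Qed.

(** * Interpolation at the multiples of h *)

Lemma has_order_coef_forward_diff n (F : R -> R) : (2 <= n)%N -> F 0 = 0 ->
  F h / h ^+ n.-1 @[h --> 0^'] --> (0 : R) ->
  (forall j, (j <= n - 2)%N -> has_order_coef n (fun h =>
    \sum_(i < n.+1) (-1) ^+ i * 'C(n, i)%:R * F (((n + j)%:R - i%:R) * h))) ->
  has_order_coef n F.
Proof.
move=> n2 F0 Fo FD.
have n0 : (0 < n)%N by exact: ltn_trans n2.
pose L i := @tnth n _ (lagrange n (fun k => k%:R : R)) i : {poly R}.
have natI : injective (fun k => k%:R : R) by exact: mulrIn (oner_neq0 R).
have Lgen (p : {poly R}) : (size p <= n)%N -> p = \sum_(i < n) p.[i%:R]%:P * L i.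
  exact: lagrange_gen.
pose P h := \sum_(i < n) (F (i%:R * h))%:P * L i.
have sP h : (size (P h) <= n)%N.
  apply: leq_trans (size_sum _ _ _) _; apply/bigmax_leqP => i _.
  rewrite mul_polyC; apply: leq_trans (size_scale_leq _ _) _.
  by rewrite (size_lagrange_ n0 natI).
have PE h (k : nat) : (k < n)%N -> (P h).[k%:R] = F (k%:R * h).
  move=> kn; rewrite horner_sum (bigD1 (Ordinal kn)) //= big1 => [|i ik].
    rewrite addr0 hornerCM.
    by rewrite (lagrange_sample n0 natI (Ordinal kn) (Ordinal kn)) eqxx mulr1.
  rewrite hornerCM (lagrange_sample n0 natI i (Ordinal kn)).
  by rewrite (negbTE ik) mulr0.
(* Strong induction: for m >= n, the difference with j = m - n involves the node m, with coefficient
   1, and the n nodes before it. The range j <= n-2 gives exactly m <= 2n-2. *)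
have EP m : (m <= 2 * n - 2)%N ->
    has_order_coef n (fun h => F (m%:R * h) - (P h).[m%:R]).
  elim/ltn_ind: m => m IHm mn; have [mltn|nm] := ltnP m n.
    exists 0; under eq_fun do rewrite PE // subrr mul0r.
    exact: cvg_cst.
  have jn : (m - n <= n - 2)%N by lia.
  have nj : (n + (m - n) = m)%N by lia.
  have D1 : has_order_coef n (fun h => \sum_(i < n)
      ((-1) ^+ i.+1 * 'C(n, i.+1)%:R) *
      (F ((m - i.+1)%:R * h) - (P h).[(m - i.+1)%:R])).
    apply: has_order_coef_sum => i _; apply: has_order_coefZ.
    by apply: IHm; have := ltn_ord i; lia.
  have := has_order_coefD (FD _ jn) (has_order_coefZ (-1) D1).
  rewrite nj; congr has_order_coef; apply/funext => h.
  have := @sum_binN_horner _ n (P h) m%:R (sP h).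
  rewrite !big_ord_recl /= !bin0 !expr0 !mul1r subr0 => /(canRL (addrK _)).
  rewrite sub0r => ->; rewrite opprK -addrA; congr (_ + _).
  rewrite mulN1r -sumrB; apply: eq_bigr => i _.
  rewrite /bump /= add1n natrB; last by have := ltn_ord i; lia.
  by ring.
have PD s : (s < n)%N ->
    has_order_coef n (fun h => (P (2 * h))`_s - 2 ^+ s * (P h)`_s).
  move=> sn.
  (* [Q h] is P_{2h}(t) - P_h(2t). Having degree < n, it is recovered from its values at the nodes k
     < n, which are F(2kh) - P_h(2k), and 2k <= 2n-2 falls under [EP]. *)
  pose Q h := \poly_(i < n) ((P (2 * h))`_i - 2 ^+ i * (P h)`_i).
  have Qs h : (P (2 * h))`_s - 2 ^+ s * (P h)`_s = (Q h)`_s.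
    by rewrite coef_poly sn.
  have QE h y : (Q h).[y] = (P (2 * h)).[y] - (P h).[2 * y].
    rewrite horner_poly !(horner_coef_wide _ (sP _)) -sumrB.
    by apply: eq_bigr => i _; rewrite exprMn; ring.
  have -> : (fun h => (P (2 * h))`_s - 2 ^+ s * (P h)`_s) = (fun h =>
      \sum_(k < n) (L k)`_s * (F ((2 * k)%:R * h) - (P h).[(2 * k)%:R])).
    apply/funext => h; rewrite Qs (Lgen (Q h)) ?size_poly //.
    rewrite coef_sum; apply: eq_bigr => k _; rewrite coefCM mulrC QE PE //.
    by rewrite natrM mulrCA mulrA.
  apply: has_order_coef_sum => k _.
  apply: has_order_coefZ; have [kn|kn] := leqP (2 * k) (2 * n - 2).
    exact: EP.
  by have := ltn_ord k; lia.
pose G s (h : R) : R := (P h)`_s.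
(* Each coefficient is a combination of the F(ih), with weights independent of h. *)
have Po s : G s h / h ^+ n.-1 @[h --> 0^'] --> (0 : R).
  suff : G s h / h ^+ n.-1 @[h --> 0^'] --> \sum_(i < n) (L i)`_s * 0.
    by rewrite big1 // => i _; rewrite mulr0.
  have PC h : G s h / h ^+ n.-1 =
      \sum_(i < n) (L i)`_s * (F (i%:R * h) / h ^+ n.-1).
    rewrite /G coef_sum mulr_suml.
    by apply: eq_bigr => i _; rewrite coefCM mulrAC mulrC.
  under eq_fun do rewrite PC.
  apply: cvg_big => [|i _]; first exact: (@add_continuous R).
  apply: cvgMl_tmp.
  have [i0|i0] := eqVneq (i%:R : R) 0.
    under eq_fun do rewrite i0 mul0r F0 mul0r.
    exact: cvg_cst.
  by have := cvg_quot_dilate i0 Fo; rewrite mulr0.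
(* Evaluation at the node 1, which is below n because n >= 2. *)
have FP h : F h = \sum_(s < n) (P h)`_s.
  have := PE h 1%N n2; rewrite mul1r => <-.
  rewrite (horner_coef_wide _ (sP h)).
  by apply: eq_bigr => i _; rewrite expr1n mulr1.
have -> : F = (fun h => \sum_(s < n) G s h) by exact/funext.
apply: has_order_coef_sum => s _.
by apply: (@has_order_coef_doubling n s) => //; exact: PD.
Qed.
End Asymp.

(** * Peano derivatives and the difference quotients *)

(** For fixed h, the polynomial y |-> p(yh) has degree < n, so its n-th difference vanishes. *)
Lemma DquotB_horner (R : realType) (n j : nat) (f : R -> R) x
    (p : {poly R}) : (size p <= n)%N ->
  forall h, Dquot n j f x h = (\sum_(i < n.+1) (-1) ^+ i * 'C(n, i)%:R *
    (f (x + ((n + j)%:R - i%:R) * h) - p.[((n + j)%:R - i%:R) * h])) / h ^+ n.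
Proof.
move=> sp h; rewrite /Dquot mulrC; congr (_ / _).
pose q := \poly_(i < n) (p`_i * h ^+ i).
have qE y : q.[y] = p.[y * h].
  rewrite horner_poly (horner_coef_wide _ sp).
  by apply: eq_bigr => i _; rewrite exprMn; ring.
have := sum_binN_horner (n + j)%:R (size_poly n (fun i => p`_i * h ^+ i)).
rewrite -/q => q0; rewrite -[LHS]subr0 -[X in _ - X]q0 -sumrB.
by apply: eq_bigr => i _; rewrite qE mulrBr.
Qed.

Lemma peano_derivP (R : realType) (f : R -> R) (x : R) (n : nat) :
  peano_deriv_exists f x n <->
  exists p : {poly R}, [/\ (size p <= n.+1)%N, p.[0] = f x &
    (f (x + h) - p.[h]) / h ^+ n @[h --> 0^'] --> (0 : R)].
Proof.
split=> [[a [a0 fa]]|[p [sp p0 fp]]].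
  exists (\poly_(i < n.+1) (a i / i`!%:R)); split; first exact: size_poly.
    by rewrite horner_coef0 coef_poly /= fact0 divr1.
  under eq_fun do rewrite horner_poly.
  by move: fa; under eq_fun do under eq_bigr do rewrite mulrAC.
exists (fun i => p`_i * i`!%:R); split.
  by rewrite fact0 mulr1 -horner_coef0.
have pE h : \sum_(i < n.+1) p`_i * i`!%:R * h ^+ i / i`!%:R = p.[h].
  rewrite (horner_coef_wide _ sp); apply: eq_bigr => i _.
  by rewrite mulrAC mulfK // pnatr_eq0 -lt0n fact_gt0.
by under eq_fun do rewrite pE.
Qed.

(** The degree n term of the Taylor polynomial moves into the limit, leaving a polynomial of degree
    < n, of the same size as the one that expresses the derivative of order n-1. *)
Lemma peano_deriv_has_order_coef (R : realType) (f : R -> R) (x : R) (n : nat) :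
  (0 < n)%N ->
  peano_deriv_exists f x n <->
  exists p : {poly R}, [/\ (size p <= n)%N, p.[0] = f x &
    has_order_coef n (fun h => f (x + h) - p.[h])].
Proof.
move=> n0; rewrite peano_derivP; split=> [[p [sp p0 fp]]|[p [sp p0 [l fp]]]].
  exists (\poly_(i < n) p`_i); split; first exact: size_poly.
    by rewrite horner_coef0 coef_poly n0 -horner_coef0.
  exists (0 + p`_n).
  suff : (f (x + h) - p.[h]) / h ^+ n + p`_n @[h --> 0^'] --> 0 + p`_n.
    apply: cvg_trans; apply: near_eq_cvg; near=> h.
    have h0 : h != 0 by near: h; exact: nbhs_dnbhs_neq.
    rewrite horner_poly (horner_coef_wide _ sp) big_ord_recr /=.
    by field; rewrite expf_neq0.
  by apply: cvgD => //; exact: cvg_cst.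
exists (p + l *: 'X^n); split.
- apply: leq_trans (size_polyD _ _) _; rewrite geq_max (leq_trans sp) //=.
  by apply: leq_trans (size_scale_leq _ _) _; rewrite size_polyXn.
- by rewrite !hornerE p0 expr0n gtn_eqF // mulr0 addr0.
suff : (f (x + h) - p.[h]) / h ^+ n - l @[h --> 0^'] --> l - l.
  rewrite subrr; apply: cvg_trans; apply: near_eq_cvg; near=> h.
  have h0 : h != 0 by near: h; exact: nbhs_dnbhs_neq.
  by rewrite !hornerE; field; rewrite expf_neq0.
by apply: cvgB => //; exact: cvg_cst.
Unshelve. all: by end_near. Qed.

Theorem theorem2 (R : realType) (n : nat) (hn : (2 <= n)%N)
  (f : R -> R) (hf : lebesgue_measurable_fun f) (x : R) :
  (peano_deriv_exists f x n.-1 /\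
     (forall j : nat, (j <= n - 2)%N -> Dnj_exists n j f x))
  <-> peano_deriv_exists f x n.
Proof.
have n0 : (0 < n)%N by exact: ltn_trans hn.
(* Both sides now ask for a polynomial of size at most n: the remainder is o(h^(n-1)) on the left
   and l h^n + o(h^n) on the right. *)
rewrite (peano_deriv_has_order_coef f x n0) peano_derivP prednK //.
split=> [[[p [sp p0 fp]] fD]|[p [sp p0 fp]]]; last split.
- exists p; split => //; apply: has_order_coef_forward_diff => //.
    by rewrite addr0 p0 subrr.
  move=> j /fD[L]; exists L.
  by under eq_fun do rewrite -(DquotB_horner j f x sp).
- exists p; split => //; case: fp => l fp.
  have : (f (x + h) - p.[h]) / h ^+ n * h @[h --> 0^'] --> (l * 0 : R).
    by apply: cvgM => //; exact: cvg_within.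
  rewrite mulr0; apply: cvg_trans; apply: near_eq_cvg; near=> h.
  have h0 : h != 0 by near: h; exact: nbhs_dnbhs_neq.
  have -> : h ^+ n = h * h ^+ n.-1 by rewrite -exprS prednK.
  by field; rewrite h0 expf_neq0.
(* The remainder at each node is a dilate of a function l h^n + o(h^n), so the limit exists for
   every j. *)
move=> j _.
suff [L fL] : has_order_coef n (fun h => \sum_(i < n.+1)
    (-1) ^+ i * 'C(n, i)%:R * (f (x + ((n + j)%:R - i%:R) * h) -
       p.[((n + j)%:R - i%:R) * h])).
  by exists L; under eq_fun do rewrite (DquotB_horner j f x sp).
apply: has_order_coef_sum => i _; apply: has_order_coefZ.
apply: (@has_order_coef_dilate _ n (fun h => f (x + h) - p.[h])) => //.
by rewrite addr0 p0 subrr.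
Unshelve. all: by end_near. Qed.
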